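(* Algorithm A, described in the context, has an approximation ratio of at most $3$ for (iK-ds) with unit improvement costs, and runs in linear time. (Approximation ratio at most $3$ means that on every instance it returns a feasible solution of (iK-ds) whose profit is at least $\tfrac13$ of the optimal objective value.)
   Context: The problem (iK-ds) with unit improvement costs (single-level improvable knapsack with discrete weight improvements): there are $n$ items; item $i$ has profit $p_i\in\mathbb{R}$, original weight $w_i\in\mathbb{R}$ and improved weight $\hat w_i\le w_i$. There are a knapsack budget $B$ and an improvement budget $k$, and improving any item costs $1$. Put $\overline w_i:=w_i-\hat w_i$. The problem is $$\max\sum_{i=1}^n p_ix_i\quad\text{s.t.}\quad \sum_{i=1}^n w_ix_i-\sum_{i=1}^n\overline w_iy_i\le B,\quad \sum_{i=1}^n y_i\le k,\quad y_i\le x_i,\quad x_i,y_i\in\{0,1\}\ \text{ for all } i\in\{1,\ldots,n\}.$$ For sets $S,T\subseteq\{1,\ldots,n\}$, $(S,T)$ denotes the solution that packs the items of $S$ with original weight and the items of $T$ with improved weight, and $p(S,T)$ denotes its profit. The auxiliary problem CKP' is obtained by doubling the items and dropping the requirement that an item is not used in both forms: $$\max\sum_{i=1}^n p_i(x_i+\hat x_i)\quad\text{s.t.}\quad \sum_{i=1}^n w_ix_i+\sum_{i=1}^n\hat w_i\hat x_i\le B,\quad \sum_{i=1}^n\hat x_i\le k,\quad x_i,\hat x_i\in\{0,1\}\ \text{ for all } i.$$ Its LP relaxation replaces $\{0,1\}$ by $[0,1]$; having a constant number of constraints besides the variable bounds, it can be solved in linear time by a known method of Megiddo and Tamir. Algorithm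 A. Input: an instance of (iK-ds) with unit improvement costs. Step 1. Solve the LP relaxation of CKP', obtaining an optimal basic solution. Let $J_I$ be the set of indices $i$ of items packed integrally with original weight ($x_i=1$), $\hat J_I$ the set of indices $i$ of items packed integrally with reduced weight ($\hat x_i=1$), and $J_F^*$ the set of item indices with fractional values; a basic solution has at most two fractional variables. Step 2. If $J_F^*=\emptyset$, return the better (by profit) of the solutions $(J_I,\emptyset)$ and $(\emptyset,\hat J_I)$. Step 3. If $J_F^*=\{i\}$ for some $i$, return the solution attaining $\max\{p(\emptyset,\{i\}),\,p(J_I,\emptyset),\,p(\emptyset,\hat J_I)\}$. Step 4. If $J_F^*=\{i,j\}$ for some $i,j$, labelled so that $\hat w_i\ge\hat w_j$, return the solution attaining $\max\{p(\emptyset,\{i\}),\,p(J_I,\emptyset),\,p(\emptyset,\hat J_I\cup\{j\})\}$.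
   Formalization: The formal theorem assumes 0 ≤ ŵ_i ≤ B for all items, B ≥ 0, and that k is an integer with k ≥ 1; without these Algorithm A can return infeasible solutions (e.g. one item with p=1, w=ŵ=10, B=5, k=1). *)

(* Defs.v *)
From mathcomp Require Import all_boot all_order all_algebra.
From mathcomp Require Import reals.

Set Implicit Arguments.
Unset Strict Implicit.
Unset Printing Implicit Defensive.

Import Order.TTheory GRing.Theory Num.Theory.
Local Open Scope ring_scope.

(* The knapsack problem (iK-ds) with unit improvement costs. *)
Record instance (R : realType) := Instance {
  nitems : nat;
  profit : 'I_nitems -> R;
  weight : 'I_nitems -> R;
  iweight : 'I_nitems -> R;   (* improved *)
  budget : R;
  ibudget : nat               (* for improvements *)
}.

Arguments nitems {R} i.
Arguments profit {R} i _.
Arguments weight {R} i _.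
Arguments iweight {R} i _.
Arguments budget {R} i.
Arguments ibudget {R} i.

(* Beyond [iweight <= weight], the usual knapsack conventions: weights are
   nonnegative, every item fits on its own in improved form, and at least one
   improvement is allowed. Feasibility and the guarantee fail without them
   (e.g. the solution packing only a fractional item would be infeasible).
   Profits are arbitrary reals. *)
Definition valid (R : realType) (I : instance R) : Prop :=
  [/\ forall i, 0 <= iweight I i <= weight I i,
      forall i, iweight I i <= budget I,
      0 <= budget I
    & (1 <= ibudget I)%N].

Definition feasible (R : realType) (I : instance R)
    (x y : 'I_(nitems I) -> bool) : Prop :=
  [/\ \sum_i weight I i * (x i)%:R
        - \sum_i (weight I i - iweight I i) * (y i)%:R <= budget I,
      (\sum_i y i <= ibudget I)%N
    & forall i, (y i <= x i)%N].

Definition objective (R : realType) (I : instance R)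
    (x : 'I_(nitems I) -> bool) : R :=
  \sum_i profit I i * (x i)%:R.

(* The solution (S, T), for disjoint S and T: the items of S are packed with
   original weight, those of T with improved weight. *)
Definition packed (n : nat) (S T : {set 'I_n}) : 'I_n -> bool :=
  fun i => i \in S :|: T.

Definition improved (n : nat) (S T : {set 'I_n}) : 'I_n -> bool :=
  fun i => i \in T.

Definition sol_profit (R : realType) (I : instance R)
    (c : {set 'I_(nitems I)} * {set 'I_(nitems I)}) : R :=
  objective (packed c.1 c.2).

Definition approximates (R : realType) (rho : R) (I : instance R)
    (S T : {set 'I_(nitems I)}) : Prop :=
  [/\ [disjoint S & T],
      feasible (packed S T) (improved S T)
    & forall x y : 'I_(nitems I) -> bool, feasible x y ->
        rho^-1 * objective x <= sol_profit (S, T)].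

(* Slacks of the knapsack and improvement constraints of the LP relaxation of
   CKP'. *)
Definition lp_slack (R : realType) (I : instance R)
    (x xh : 'I_(nitems I) -> R) (r : 'I_2) : R :=
  if r == 0
  then budget I - (\sum_i weight I i * x i + \sum_i iweight I i * xh i)
  else (ibudget I)%:R - \sum_i xh i.

Definition lp_feasible (R : realType) (I : instance R)
    (x xh : 'I_(nitems I) -> R) : Prop :=
  [/\ \sum_i weight I i * x i + \sum_i iweight I i * xh i <= budget I,
      \sum_i xh i <= (ibudget I)%:R
    & forall i, (0 <= x i <= 1) /\ (0 <= xh i <= 1)].

Definition lp_objective (R : realType) (I : instance R)
    (x xh : 'I_(nitems I) -> R) : R :=
  \sum_i profit I i * (x i + xh i).

Definition lp_optimal (R : realType) (I : instance R)
    (x xh : 'I_(nitems I) -> R) : Prop :=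
  lp_feasible x xh /\
  forall z zh : 'I_(nitems I) -> R, lp_feasible z zh ->
    lp_objective z zh <= lp_objective x xh.

(* Variables of the LP in equality form: the x_i, the xh_i, and the slacks of
   the two constraints. *)
Inductive lp_var (n : nat) :=
  Orig of 'I_n | Impr of 'I_n | Slack of 'I_2.

Definition lp_column (R : realType) (I : instance R)
    (v : lp_var (nitems I)) (r : 'I_2) : R :=
  match v with
  | Orig i => if r == 0 then weight I i else 0
  | Impr i => if r == 0 then iweight I i else 1
  | Slack s => (r == s)%:R
  end.

(* Slacks are only bounded below. *)
Definition at_bound (R : realType) (I : instance R)
    (x xh : 'I_(nitems I) -> R) (v : lp_var (nitems I)) : Prop :=
  match v with
  | Orig i => x i = 0 \/ x i = 1
  | Impr i => xh i = 0 \/ xh i = 1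
  | Slack s => lp_slack x xh s = 0
  end.

(* Basic solutions in the sense of linear programming with bounded variables:
   some basis of two columns is such that every nonbasic variable is at one of
   its bounds. *)
Definition lp_basic (R : realType) (I : instance R)
    (x xh : 'I_(nitems I) -> R) : Prop :=
  exists b : 'I_2 -> lp_var (nitems I),
    (\matrix_(r < 2, c < 2) lp_column (b c) r) \in unitmx /\
    forall v, (forall c, b c <> v) -> at_bound x xh v.

Definition lp_optimal_basic (R : realType) (I : instance R)
    (x xh : 'I_(nitems I) -> R) : Prop :=
  lp_optimal x xh /\ lp_basic x xh.

Definition int_set (R : realType) (n : nat) (x : 'I_n -> R) : {set 'I_n} :=
  [set i | x i == 1].

Definition frac_set (R : realType) (n : nat) (x xh : 'I_n -> R) : {set 'I_n} :=
  [set i | (0 < x i < 1) || (0 < xh i < 1)].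

Definition best_of (R : realType) (I : instance R)
    (cs : seq ({set 'I_(nitems I)} * {set 'I_(nitems I)}))
    (c : {set 'I_(nitems I)} * {set 'I_(nitems I)}) : Prop :=
  c \in cs /\ forall c', c' \in cs -> sol_profit c' <= sol_profit c.

(* A relation, since ties and the labelling of i, j may be resolved arbitrarily. *)
Inductive rounding (R : realType) (I : instance R)
    (x xh : 'I_(nitems I) -> R) (c : {set 'I_(nitems I)} * {set 'I_(nitems I)})
    : Prop :=
| Step2 of
    frac_set x xh = set0 &
    best_of [:: (int_set x, set0); (set0, int_set xh)] c
| Step3 i of
    frac_set x xh = [set i] &
    best_of [:: (set0, [set i]); (int_set x, set0); (set0, int_set xh)] c
| Step4 i j of
    i != j & frac_set x xh = [set i; j] & iweight I j <= iweight I i &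
    best_of [:: (set0, [set i]); (int_set x, set0); (set0, j |: int_set xh)] c.

Definition algorithmA (R : realType) (I : instance R)
    (S T : {set 'I_(nitems I)}) : Prop :=
  exists x xh : 'I_(nitems I) -> R,
    lp_optimal_basic x xh /\ rounding x xh (S, T).

(* Running time is measured on a unit-cost real RAM with structured programs.
   The memory consists of arrays of natural numbers and arrays of reals; a
   program mentions finitely many array names. Naturals support only addition
   and truncated subtraction, reals cannot be rounded to naturals, and no real
   constants are available besides casts of naturals. *)
Record state (R : realType) := State {
  nats : nat -> nat -> nat;    (* array name, index *)
  reals : nat -> nat -> R
}.

(* [Var v] is the number stored in cell 0 of the array [v] of naturals. *)
Inductive offset := Const of nat | Var of nat.

Definition loc : Type := nat * offset.

Inductive instr :=
| NSet of loc & nat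
| NMove of loc & loc
| NAdd of loc & loc & loc
| NSub of loc & loc & loc
| RCast of loc & loc
| RMove of loc & loc
| RAdd of loc & loc & loc
| RSub of loc & loc & loc
| RMul of loc & loc & loc
| RDiv of loc & loc & loc.

Inductive test := NLt of loc & loc | RLt of loc & loc.

Inductive cmd :=
| Do of instr
| Seq of cmd & cmd
| If of test & cmd & cmd
| While of test & cmd.

Definition addr (R : realType) (s : state R) (e : offset) : nat :=
  match e with Const i => i | Var v => nats s v 0 end.

Definition nval (R : realType) (s : state R) (l : loc) : nat :=
  nats s l.1 (addr s l.2).

Definition rval (R : realType) (s : state R) (l : loc) : R :=
  reals s l.1 (addr s l.2).

Definition upd (T : Type) (m : nat -> nat -> T) (a i : nat) (v : T) :
    nat -> nat -> T :=
  fun a' i' => if (a' == a) && (i' == i) then v else m a' i'.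

Definition nput (R : realType) (s : state R) (l : loc) (v : nat) : state R :=
  State (upd (nats s) l.1 (addr s l.2) v) (reals s).

Definition rput (R : realType) (s : state R) (l : loc) (v : R) : state R :=
  State (nats s) (upd (reals s) l.1 (addr s l.2) v).

Definition run_instr (R : realType) (i : instr) (s : state R) : state R :=
  match i with
  | NSet d c => nput s d c
  | NMove d a => nput s d (nval s a)
  | NAdd d a b => nput s d (nval s a + nval s b)%N
  | NSub d a b => nput s d (nval s a - nval s b)%N
  | RCast d a => rput s d (nval s a)%:R
  | RMove d a => rput s d (rval s a)
  | RAdd d a b => rput s d (rval s a + rval s b)
  | RSub d a b => rput s d (rval s a - rval s b)
  | RMul d a b => rput s d (rval s a * rval s b)
  | RDiv d a b => rput s d (rval s a / rval s b)
  end.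

Definition eval_test (R : realType) (t : test) (s : state R) : bool :=
  match t with
  | NLt a b => (nval s a < nval s b)%N
  | RLt a b => rval s a < rval s b
  end.

(* [exec c s t s']: started in [s], [c] halts in [s'] after [t] steps. *)
Inductive exec (R : realType) : cmd -> state R -> nat -> state R -> Prop :=
| ExecDo i s : exec (Do i) s 1 (run_instr i s)
| ExecSeq c1 c2 s1 s2 s3 t1 t2 :
    exec c1 s1 t1 s2 -> exec c2 s2 t2 s3 -> exec (Seq c1 c2) s1 (t1 + t2) s3
| ExecIfTrue b c1 c2 s s' t :
    eval_test b s -> exec c1 s t s' -> exec (If b c1 c2) s t.+1 s'
| ExecIfFalse b c1 c2 s s' t :
    ~~ eval_test b s -> exec c2 s t s' -> exec (If b c1 c2) s t.+1 s'
| ExecWhileTrue b c s1 s2 s3 t1 t2 :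
    eval_test b s1 -> exec c s1 t1 s2 -> exec (While b c) s2 t2 s3 ->
    exec (While b c) s1 (t1 + t2).+1 s3
| ExecWhileFalse b c s :
    ~~ eval_test b s -> exec (While b c) s 1 s.

(* Input: nats 0 and 1 hold the number of items and the improvement budget;
   reals 0, 1, 2, 3 hold the profits, the weights, the improved weights and the
   knapsack budget. All other cells are initially zero. *)
Definition of_vec (R : realType) (n : nat) (f : 'I_n -> R) (i : nat) : R :=
  oapp f 0 (insub i).

Definition init (R : realType) (I : instance R) : state R :=
  State
    (fun a i => match a, i with
                | 0, 0 => nitems I
                | 1, 0 => ibudget I
                | _, _ => 0
                end%N)
    (fun a i => match a, i with
                | 0%N, _ => of_vec (profit I) i
                | 1%N, _ => of_vec (weight I) i
                | 2%N, _ => of_vec (iweight I) i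
                | 3%N, 0%N => budget I
                | _, _ => 0
                end).

Definition holds_input (R : realType) (I : instance R) (s : state R) : Prop :=
  [/\ nats s 0 0 = nitems I,
      nats s 1 0 = ibudget I,
      reals s 3 0 = budget I
    & forall i : 'I_(nitems I),
        [/\ reals s 0 i = profit I i, reals s 1 i = weight I i
          & reals s 2 i = iweight I i]].

Definition linear_time (R : realType) (c : cmd)
    (post : instance R -> state R -> Prop) : Prop :=
  exists C : nat, forall I : instance R, valid I ->
    exists (t : nat) (s : state R),
      [/\ exec c (init I) t s, (t <= C * (nitems I).+1)%N & post I s].

(* The role played by the Megiddo-Tamir method: the LP solution is left in the
   real arrays 4 and 5, and the input is kept. *)
Definition linear_time_lp_solver (R : realType) (lp : cmd) : Prop :=
  linear_time lp (fun (I : instance R) s =>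
    holds_input I s /\
    @lp_optimal_basic R I (fun i => reals s 4 i) (fun i => reals s 5 i)).

(* The vectors x and y of the computed solution are left in the arrays 2 and 3
   of naturals. *)
Definition linear_time_algorithmA (R : realType) (c : cmd) : Prop :=
  linear_time c (fun (I : instance R) s =>
    exists S T : {set 'I_(nitems I)},
      algorithmA S T /\
      forall i : 'I_(nitems I),
        nats s 2 i = packed S T i /\ nats s 3 i = improved S T i).

(* Main.v *)
Require Import Defs.
From mathcomp Require Import all_boot all_order all_algebra.
From mathcomp Require Import boolp reals.
From mathcomp Require Import lra zify.

(** Splitting a feasible solution into items packed with original and with
    improved weight gives a solution of the linear relaxation, so the value of
    the relaxation is at least the optimum ([objective_le_lp]). Let [J] and [H]
    be the items whose original, respectively improved, copy is packed
    integrally. There are two constraints, so at most two variables of a basic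
    solution are fractional. If there are two, both constraints are tight, and a
    look at the two basic columns and at the integrality of the improvement
    budget shows that they are improved copies of two different items
    ([two_fractional]). Hence no item has both copies fractional, and the value
    of the relaxation is at most p(J) + p(H) plus the full profits of the
    fractional items ([lp_objective_le]); profits of packed items are
    nonnegative by optimality ([profit_ge0]).

    If [i] is the only fractional item, the three summands p(J), p(H) and p(i)
    are the profits of the three candidates. If [i] and [j] are fractional and
    [j] is the lighter one, the candidates earn p(J), p(H) + p(j) and p(i). The
    only feasibility that is not immediate is that of [j |: H]. The fractions of
    [i] and [j] sum to at least one by tightness of the improvement constraint,
    so one more improvement is available, and packing [j] in full weighs no more
    than those fractions did ([two_items_fractional], [admissible_lighter]).

    For the running time, an explicit program scans the items once to
    recover [J], [H], their profits and the at most two fractional items, then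
    compares three numbers, and scans once more to write the winner. Loop-free
    programs are evaluated by the function [run], and the two scans are handled
    by loop invariants ([halts_while]). *)

Set Implicit Arguments.
Unset Strict Implicit.
Unset Printing Implicit Defensive.

Import Order.TTheory GRing.Theory Num.Theory.
Local Open Scope ring_scope.

(** * The relaxation bounds the problem *)

Section LPSolution.
Variables (R : realType) (I : instance R).
Local Notation n := (nitems I).
Implicit Types (x xh : 'I_n -> R) (S T : {set 'I_n}).

Lemma sum_indicator (f : 'I_n -> R) (A : pred 'I_n) :
  \sum_i f i * (A i)%:R = \sum_(i | A i) f i.
Proof.
rewrite [RHS]big_mkcond; apply: eq_bigr => i _.
by case: (A i); rewrite ?mulr1 ?mulr0.
Qed.

Lemma sol_profitE S T : sol_profit (S, T) = \sum_(i in S :|: T) profit I i.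
Proof. exact: sum_indicator. Qed.

Lemma feasible_packed S T :
    [disjoint S & T] ->
    \sum_(i in S) weight I i + \sum_(i in T) iweight I i <= budget I ->
    (#|T| <= ibudget I)%N ->
  feasible (packed S T) (improved S T).
Proof.
move=> dST wST cT; split.
- rewrite /packed /improved !sum_indicator; apply: le_trans wST.
  rewrite (eq_bigl [predU S & T]) => [|i]; last by rewrite !inE.
  by rewrite bigU //= sumrB; lra.
- by rewrite /improved -big_mkcond sum1_card.
- by move=> i; rewrite /packed /improved inE; case: (i \in T); rewrite ?orbT.
Qed.

Lemma objective_le_lp x xh (y z : 'I_n -> bool) :
  valid I -> lp_optimal x xh -> feasible y z -> objective y <= lp_objective x xh.
Proof.
move=> [wP _ _ _] [_ opt] [wyz cz zy].
have -> : objective y = lp_objective (fun i => (y i && ~~ z i)%:R) (fun i => (z i)%:R).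
  apply: eq_bigr => i _; congr (_ * _); rewrite -natrD.
  by move: (zy i); case: (y i); case: (z i).
apply: opt; split.
- apply: le_trans wyz; rewrite -sumrB -big_split; apply: ler_sum => i _ /=.
  by move: (zy i); case: (y i); case: (z i) => //= _; lra.
- by rewrite -natr_sum ler_nat.
- by move=> i; case: (y i); case: (z i); rewrite /= ?lexx ?ler01.
Qed.

Lemma lp_objective_ge0 x xh : valid I -> lp_optimal x xh -> 0 <= lp_objective x xh.
Proof.
move=> vI opt; have [_ _ B0 _] := vI.
have f0 : @feasible _ I (fun=> false) (fun=> false).
  by split=> //; rewrite ?big1 ?subr0 // => i _; rewrite mulr0.
apply: le_trans (objective_le_lp vI opt f0).
by rewrite /objective big1 // => i _; rewrite mulr0.
Qed.

(** Unpacking an item saves weight and improvements, so an optimum keeps no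
    item of negative profit. This is what makes a fractional item worth at most
    its full profit, although profits are arbitrary reals. *)
Lemma profit_ge0 x xh i :
  valid I -> lp_optimal x xh -> (0 < x i) || (0 < xh i) -> 0 <= profit I i.
Proof.
move=> [wP _ _ _] [[wx cx bx] opt] posi.
pose z (u : 'I_n -> R) l := if l == i then 0 else u l.
have zle (u : 'I_n -> R) l : 0 <= u l -> 0 <= z u l <= u l.
  by rewrite /z; case: eqP => _ ul; rewrite ?lexx ul.
have zf : lp_feasible (z x) (z xh).
  split.
  - apply: le_trans wx; apply: lerD; apply: ler_sum => l _;
    have /andP[wh0 whw] := wP l; have [/andP[x0 x1] /andP[xh0 xh1]] := bx l.
      by have /andP[_ ?] := zle x l x0; apply: ler_wpM2l => //; lra.
    by have /andP[_ ?] := zle xh l xh0; apply: ler_wpM2l.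
  - apply: le_trans cx; apply: ler_sum => l _.
    by have [_ /andP[xh0 _]] := bx l; case/andP: (zle xh l xh0).
  - move=> l; have [/andP[x0 x1] /andP[xh0 xh1]] := bx l.
    have := zle x l x0; have := zle xh l xh0; lra.
have := opt _ _ zf; rewrite /lp_objective (bigD1 i) //= [leRHS](bigD1 i) //=.
rewrite {1 2}/z eqxx addr0 mulr0 add0r.
rewrite (eq_bigr (fun l => profit I l * (x l + xh l))); last first.
  by move=> l /negbTE li; rewrite /z li.
rewrite lerDr pmulr_lge0 //.
by have [/andP[x0 x1] /andP[xh0 xh1]] := bx i; case/orP: posi; lra.
Qed.

(** * Fractional variables of a basic solution *)

Definition fractional x xh (v : lp_var n) : bool :=
  match v with
  | Orig i => 0 < x i < 1
  | Impr i => 0 < xh i < 1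
  | Slack _ => false
  end.

Lemma fractional_notin (u : 'I_n -> R) i : 0 < u i < 1 -> i \notin int_set u.
Proof. by rewrite inE => /andP[_]; rewrite lt_neqAle => /andP[]. Qed.

Lemma in_frac_set x xh i :
  (i \in frac_set x xh) = fractional x xh (Orig i) || fractional x xh (Impr i).
Proof. by rewrite inE. Qed.

(** A variable strictly between its bounds is at neither of them, hence basic;
    with two constraints there are at most two such variables. *)
Lemma fractional_basic x xh (b : 'I_2 -> lp_var n) v :
    (forall v, (forall c, b c <> v) -> at_bound x xh v) ->
  fractional x xh v -> exists c, b c = v.
Proof.
move=> atb fv; apply: contrapT => nb.
have : at_bound x xh v by apply: atb => c bc; apply: nb; exists c.
by case: v fv {nb} => //= i /andP[p0 p1] [] E; move: p0 p1; rewrite E ltxx.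
Qed.

(** Sending each basic variable to its item covers the fractional items by the
    image of a set with two elements. *)
Lemma card_frac_set x xh : lp_basic x xh -> (#|frac_set x xh| <= 2)%N.
Proof.
move=> [b [_ atb]].
pose item (v : lp_var n) := match v with Orig i | Impr i => Some i | Slack _ => None end.
rewrite -(card_imset _ (@Some_inj _)) -[X in (_ <= X)%N](card_ord 2) -cardsT.
apply: leq_trans (leq_imset_card (item \o b) _).
apply/subset_leq_card/subsetP => _ /imsetP[i Fi ->].
move: Fi; rewrite in_frac_set => /orP[] /(fractional_basic atb)[c bc];
  by apply/imsetP; exists c; rewrite //= bc.
Qed.

Lemma sum_xh x xh :
    lp_feasible x xh ->
  \sum_i xh i = #|int_set xh|%:R + \sum_(i | 0 < xh i < 1) xh i.
Proof.
move=> [_ _ bx]; rewrite -sum1_card natr_sum.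
rewrite [X in X + _]big_mkcond [X in _ + X]big_mkcond -big_split /=.
apply: eq_bigr => i _; rewrite inE; have [_ /andP[]] := bx i.
rewrite [0 <= _]le_eqVlt [_ <= 1]le_eqVlt.
case: eqP => [<- _|_ /= ->].
  by rewrite eq_sym oner_eq0 ltxx addr0.
by case: eqP => [->|_ /= ->]; rewrite ?ltxx ?addr0 ?add0r.
Qed.

(** Two fractional variables fill the basis, so both slacks are nonbasic and
    both constraints are tight. Two original copies are impossible, as their
    columns vanish in the row of the improvement constraint. One copy of each
    kind is impossible, as [ibudget I] would then be a sum of integers and of
    one proper fraction. *)
Lemma two_fractional x xh u v :
    lp_feasible x xh -> lp_basic x xh ->
    fractional x xh u -> fractional x xh v -> u <> v ->
  exists i j : 'I_n,
    [/\ u = Impr i, v = Impr j, lp_slack x xh 1 = 0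
      & \sum_i xh i = #|int_set xh|%:R + xh i + xh j].
Proof.
move=> feas [b [unitb atb]] fu fv uv.
have [cu bu] := fractional_basic atb fu.
have [cv bv] := fractional_basic atb fv.
have cuv : cu != cv by apply/eqP => cc; apply: uv; rewrite -bu -bv cc.
have bE c : b c = u \/ b c = v.
  suff /orP[/eqP->|/eqP->] : (c == cu) || (c == cv) by [left|right|].
  by move: cuv; case: c cu cv {bu bv} => [[|[|//]] ?] [[|[|//]] ?] [[|[|//]] ?].
have slack s : lp_slack x xh s = 0.
  suff : at_bound x xh (Slack _ s) by [].
  by apply: atb => c; case: (bE c) => -> vs; [move: fu|move: fv]; rewrite vs.
have fracE w : fractional x xh w -> w = u \/ w = v.
  by move/(fractional_basic atb) => [c <-].
have sumE := sum_xh feas.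
have sumk : \sum_i xh i = (ibudget I)%:R.
  by apply/eqP; rewrite eq_sym -subr_eq0; apply/eqP; exact: (slack 1).
have one_impr i : (forall j, 0 < xh j < 1 -> j = i) -> 0 < xh i < 1 -> False.
  move=> only fi; move: sumk; rewrite sumE (big_pred1 i); last first.
    by move=> j /=; apply/idP/eqP => [|->//]; apply: only.
  case/andP: fi => i0 i1 E.
  have : #|int_set xh|%:R < (ibudget I)%:R :> R by lra.
  have : (ibudget I)%:R < #|int_set xh|.+1%:R :> R by rewrite -natr1; lra.
  by rewrite !ltr_nat ltnS => /leq_ltn_trans h /h; rewrite ltnn.
case: u v fu fv uv bE fracE {bu bv} => [i|i|//] [j|j|//] /= fu fv uv bE fracE.
(* Two original copies: row 1 of the basis matrix is zero. *)
- exfalso; move/matrixP/(_ 1 1): (mulmxV unitb); rewrite !mxE eqxx => /eqP.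
  rewrite big1 1?eq_sym ?oner_eq0 // => c _.
  by rewrite mxE; case: (bE c) => ->; rewrite /= mul0r.
- by exfalso; apply: (one_impr j _ fv) => l /(fracE (Impr l))[//|[]].
- by exfalso; apply: (one_impr i _ fu) => l /(fracE (Impr l))[[]|//].
exists i, j; split=> //; rewrite sumE -addrA; congr (_ + _).
have ij : i != j by apply/eqP => ij; apply: uv; rewrite ij.
rewrite (bigD1 i) //= (big_pred1 j) // => l /=.
apply/andP/eqP => [[/(fracE (Impr l))[[->]|[->]] //]|->].
  by rewrite eqxx.
by rewrite eq_sym.
Qed.

Lemma one_form_fractional x xh i :
  lp_feasible x xh -> lp_basic x xh -> 0 < x i < 1 -> 0 < xh i < 1 -> False.
Proof.
move=> feas basic fx fxh.
have [] := @two_fractional _ _ (Orig i) (Impr i) feas basic fx fxh; first by [].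
by move=> ? [? []].
Qed.

(** The improvement constraint is tight and its integral part takes
    [#|int_set xh|] units, so the two fractions sum to a positive integer. Room
    for one more improved item remains, and the two fractions weigh at least as
    much as the lighter of the two items. *)
Lemma two_items_fractional x xh i j :
    lp_feasible x xh -> lp_basic x xh -> i != j ->
    i \in frac_set x xh -> j \in frac_set x xh ->
  [/\ 0 < xh i < 1, 0 < xh j < 1, (#|int_set xh| < ibudget I)%N
    & 1 <= xh i + xh j].
Proof.
move=> feas basic ij; rewrite !in_frac_set => Fi Fj.
have [u fu ui] : exists2 u, fractional x xh u & u = Orig i \/ u = Impr i.
  by case/orP: Fi => ?; [exists (Orig i)|exists (Impr i)]; auto.
have [v fv vj] : exists2 v, fractional x xh v & v = Orig j \/ v = Impr j.
  by case/orP: Fj => ?; [exists (Orig j)|exists (Impr j)]; auto.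
have uv : u <> v.
  by case: ui vj => [->|->] [->|->] // [] /eqP; rewrite (negbTE ij).
have [i' [j' [ui' vj' slk sumE]]] := two_fractional feas basic fu fv uv.
have ii' : i' = i by case: ui => h; move: h; rewrite ui' => // -[].
have jj' : j' = j by case: vj => h; move: h; rewrite vj' => // -[].
move: fu fv; rewrite ui' vj' ii' jj' /= => fi fj.
move: slk; rewrite /lp_slack /= sumE ii' jj' => slk.
have lt : (#|int_set xh| < ibudget I)%N.
  by rewrite -(ltr_nat R); lra.
split=> //.
by move: lt; rewrite -(ler_nat R) -natr1; lra.
Qed.

(** The bound holds item by item. Since no item has both copies fractional,
    [x i + xh i] is at most the number of integrally packed copies, plus one if
    the item is fractional. *)
Lemma lp_objective_le x xh :
    valid I -> lp_optimal x xh -> lp_basic x xh ->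
  lp_objective x xh <= sol_profit (int_set x, set0)
    + sol_profit (set0, int_set xh) + \sum_(i in frac_set x xh) profit I i.
Proof.
move=> vI opt basic; have feas := opt.1; have [_ _ bx] := feas.
have setE S : \sum_(i in S) profit I i = \sum_i profit I i * (i \in S)%:R.
  by rewrite (sum_indicator _ [in S]).
rewrite !sol_profitE setU0 set0U !setE -!big_split /=.
apply: ler_sum => i _; rewrite -!mulrDr !inE.
have [/andP[x0 x1] /andP[xh0 xh1]] := bx i.
have [/orP pos|] := boolP ((0 < x i) || (0 < xh i)); last first.
  rewrite negb_or -!leNgt => /andP[x0' xh0'].
  have -> : x i = 0 by lra.
  have -> : xh i = 0 by lra.
  by rewrite eq_sym oner_eq0 ltxx !addr0.
have p0 : 0 <= profit I i by apply: (profit_ge0 vI opt); apply/orP.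
have le1 : x i + xh i <= (x i == 1)%:R + (xh i == 1)%:R +
                         ((0 < x i < 1) || (0 < xh i < 1))%:R.
  have := @one_form_fractional x xh i feas basic.
  have [->|nx1] := eqVneq (x i) 1; have [->|nxh1] := eqVneq (xh i) 1;
    rewrite ?ltxx ?andbF ?orbF /=;
    rewrite ?[x i < 1]lt_neqAle ?[xh i < 1]lt_neqAle ?nx1 ?nxh1 ?x1 ?xh1 ?andbT /=.
  - by rewrite addr0.
  - by case: ltP => h _ /=; lra.
  - by case: ltP => h _ /=; lra.
  - case: ltP => h; case: ltP => h' both /=; [by case: both| | |]; lra.
exact: ler_wpM2l.
Qed.

Lemma best_of_exists (c0 : {set 'I_n} * {set 'I_n}) cs :
  exists c, best_of (c0 :: cs) c.
Proof.
elim: cs c0 => [|c1 cs IH] c0.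
  by exists c0; split=> [|c]; rewrite inE // => /eqP->.
have [c [cin cbest]] := IH c1.
have [le|lt] := lerP (sol_profit c0) (sol_profit c).
  exists c; split=> [|c']; first by rewrite inE cin orbT.
  by rewrite inE => /predU1P[->|/cbest].
exists c0; split=> [|c']; first by rewrite inE eqxx.
by rewrite inE => /predU1P[->//|/cbest] /le_trans; apply; apply: ltW.
Qed.

Lemma rounding_exists x xh :
  lp_basic x xh -> exists S T : {set 'I_n}, rounding x xh (S, T).
Proof.
move=> /card_frac_set; case card: #|frac_set x xh| => [|[|[|//]]] _.
- have [[S T] best] := best_of_exists (int_set x, set0) [:: (set0, int_set xh)].
  by exists S, T; apply: Step2 best; apply: cards0_eq.
- have /cards1P[i Fi] : #|frac_set x xh| == 1%N by rewrite card.
  have [[S T] best] := best_of_exists (set0, [set i])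
    [:: (int_set x, set0); (set0, int_set xh)].
  by exists S, T; apply: Step3 best.
have /cards2P[i [j [ij Fij]]] : #|frac_set x xh| == 2%N by rewrite card.
wlog wij : i j ij Fij / iweight I j <= iweight I i.
  move=> wlg; case/orP: (le_total (iweight I j) (iweight I i)); first exact: wlg.
  by apply: wlg; rewrite ?Fij 1?eq_sym // setUC.
have [[S T] best] := best_of_exists (set0, [set i])
  [:: (int_set x, set0); (set0, j |: int_set xh)].
by exists S, T; apply: Step4 ij Fij wij best.
Qed.

(** * Candidates and the approximation ratio *)

Definition admissible (c : {set 'I_n} * {set 'I_n}) : Prop :=
  [disjoint c.1 & c.2] /\ feasible (packed c.1 c.2) (improved c.1 c.2).

Lemma admissible_original x xh :
  valid I -> lp_feasible x xh -> admissible (int_set x, set0).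
Proof.
move=> [wP _ _ _] [wx _ bx].
have d0 : [disjoint int_set x & set0] by rewrite disjoint_sym disjoints_subset sub0set.
split=> //; apply: feasible_packed; rewrite ?cards0 // big_set0 addr0; apply: le_trans wx.
rewrite -[leLHS]addr0; apply: lerD; last first.
  apply: sumr_ge0 => i _; have /andP[? _] := wP i.
  by have [_ /andP[? _]] := bx i; apply: mulr_ge0.
rewrite big_mkcond; apply: ler_sum => i _; rewrite inE.
have /andP[wh0 whw] := wP i; have [/andP[x0 _] _] := bx i.
case: eqP => [->|_]; first by rewrite mulr1.
by apply: mulr_ge0 => //; lra.
Qed.

Lemma admissible_improved T :
    \sum_(i in T) iweight I i <= budget I -> (#|T| <= ibudget I)%N ->
  admissible (set0, T).
Proof.
move=> wT cT.
have d0 : [disjoint set0 & T] by rewrite disjoints_subset sub0set.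
by split=> //; apply: feasible_packed; rewrite // big_set0 add0r.
Qed.

Lemma admissible_singleton i : valid I -> admissible (set0, [set i]).
Proof.
move=> [_ whB _ k1]; apply: admissible_improved; last by rewrite cards1.
by rewrite big_set1.
Qed.

Lemma int_iweight_le x xh :
    valid I -> lp_feasible x xh ->
  \sum_(i in int_set xh) iweight I i + \sum_(i | 0 < xh i < 1) iweight I i * xh i
    <= budget I.
Proof.
move=> [wP _ _ _] [wx _ bx]; apply: le_trans wx.
apply: le_trans (_ : \sum_i iweight I i * xh i <= _); last first.
  rewrite lerDr; apply: sumr_ge0 => i _.
  by have /andP[? ?] := wP i; have [/andP[? _] _] := bx i; apply: mulr_ge0 => //; lra.
rewrite [X in X + _]big_mkcond [X in _ + X]big_mkcond -big_split /=.
apply: ler_sum => i _; rewrite inE.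
have [_ /andP[xh0 xh1]] := bx i; have /andP[wh0 _] := wP i.
have [->|_] := eqVneq; first by rewrite ltxx andbF mulr1 addr0.
by case: ifP => _; rewrite add0r // mulr_ge0.
Qed.

Lemma admissible_int_improved x xh :
  valid I -> lp_feasible x xh -> admissible (set0, int_set xh).
Proof.
move=> vI feas; have [_ cx bx] := feas; have [wP _ _ _] := vI.
apply: admissible_improved.
  apply: le_trans (int_iweight_le vI feas); rewrite lerDl; apply: sumr_ge0 => i _.
  by have [_ /andP[? _]] := bx i; have /andP[? _] := wP i; apply: mulr_ge0.
rewrite -(ler_nat R); apply: le_trans cx; rewrite (sum_xh feas) lerDl.
by apply: sumr_ge0 => i _; have [_ /andP[? _]] := bx i.
Qed.

(** The lighter item [j], packed in full, takes no more room than the fractions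
    of [i] and [j] that it replaces. *)
Lemma admissible_lighter x xh i j :
    valid I -> lp_feasible x xh -> lp_basic x xh -> i != j ->
    i \in frac_set x xh -> j \in frac_set x xh -> iweight I j <= iweight I i ->
  admissible (set0, j |: int_set xh).
Proof.
move=> vI feas basic ij Fi Fj wij; have [wP _ _ _] := vI; have [_ _ bx] := feas.
have [fi fj lt sum1] := two_items_fractional feas basic ij Fi Fj.
have jH := fractional_notin fj.
apply: admissible_improved; last by rewrite cardsU1 jH.
apply: le_trans (int_iweight_le vI feas); rewrite big_setU1 //= addrC lerD2l.
rewrite (bigD1 i) //= (bigD1 j) /=; last by rewrite fj eq_sym.
rewrite addrA ler_wpDr //.
  apply: sumr_ge0 => l _; have /andP[? _] := wP l.
  by have [_ /andP[? _]] := bx l; apply: mulr_ge0.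
have /andP[? _] := wP j; have /andP[? _] := fi; have /andP[? _] := fj.
by nra.
Qed.

(** The upper bound on the relaxation is the sum of the profits of at most three
    candidates, so the best of them earns a third of it. If nothing is
    fractional, two candidates earn the whole; passing from a half to a third
    uses that the relaxation has nonnegative value. *)
Lemma rounding_approximates x xh S T :
    valid I -> lp_optimal_basic x xh -> rounding x xh (S, T) ->
  approximates 3 S T.
Proof.
move=> vI [opt basic] rnd; have feas := opt.1.
have bound := lp_objective_le vI opt basic; have lp0 := lp_objective_ge0 vI opt.
suff [[dST fST] lp3] : admissible (S, T) /\ lp_objective x xh <= 3 * sol_profit (S, T).
  split=> // y z fyz; have := objective_le_lp vI opt fyz; lra.
have aJ := admissible_original vI feas; have aH := admissible_int_improved vI feas.
case: rnd => [F0 [inc best]|i F1 [inc best]|i j ij F2 wij [inc best]].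
- have := best _ (mem_head _ _).
  have : sol_profit (set0, int_set xh) <= sol_profit (S, T)
    by apply: best; rewrite !inE eqxx orbT.
  split; last by move: bound; rewrite F0 big_set0; lra.
  by move: inc; rewrite !inE => /orP[]/eqP->.
- have : sol_profit (set0, [set i]) <= sol_profit (S, T) by apply: best; rewrite mem_head.
  have : sol_profit (int_set x, set0) <= sol_profit (S, T)
    by apply: best; rewrite !inE eqxx orbT.
  have : sol_profit (set0, int_set xh) <= sol_profit (S, T)
    by apply: best; rewrite !inE eqxx !orbT.
  rewrite [sol_profit (_, [set i])]sol_profitE set0U big_set1.
  split; last by move: bound; rewrite F1 big_set1; lra.
  by move: inc; rewrite !inE => /or3P[]/eqP-> //; apply: admissible_singleton.
have Fi : i \in frac_set x xh by rewrite F2 !inE eqxx.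
have Fj : j \in frac_set x xh by rewrite F2 !inE eqxx orbT.
have [_ fj _ _] := two_items_fractional feas basic ij Fi Fj.
have jH := fractional_notin fj.
have : sol_profit (set0, [set i]) <= sol_profit (S, T) by apply: best; rewrite mem_head.
have : sol_profit (int_set x, set0) <= sol_profit (S, T)
    by apply: best; rewrite !inE eqxx orbT.
have : sol_profit (set0, j |: int_set xh) <= sol_profit (S, T)
    by apply: best; rewrite !inE eqxx !orbT.
move: bound; rewrite F2 big_setU1 ?inE //= big_set1.
rewrite [sol_profit (_, [set i])]sol_profitE [sol_profit (_, _ |: _)]sol_profitE.
rewrite [sol_profit (_, int_set _)]sol_profitE !set0U big_set1 big_setU1 //=.
split; last by lra.
move: inc; rewrite !inE => /or3P[]/eqP-> //; first exact: admissible_singleton.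
exact: admissible_lighter Fi Fj wij.
Qed.

End LPSolution.

(** * Execution of loop-free programs and counting loops *)

Fixpoint loopfree (c : cmd) : bool :=
  match c with
  | Do _ => true
  | Seq c1 c2 | If _ c1 c2 => loopfree c1 && loopfree c2
  | While _ _ => false
  end.

Fixpoint cmd_size (c : cmd) : nat :=
  match c with
  | Do _ => 1
  | Seq c1 c2 => cmd_size c1 + cmd_size c2
  | If _ c1 c2 => (cmd_size c1 + cmd_size c2).+1
  | While _ c1 => (cmd_size c1).+1
  end.

(** Without loops, [exec] is a function of the start state, which can be computed
    instead of searched for; the value at [While] is a dummy. *)
Fixpoint run (R : realType) (c : cmd) (s : state R) : state R :=
  match c with
  | Do i => run_instr i s
  | Seq c1 c2 => run c2 (run c1 s)
  | If b c1 c2 => if eval_test b s then run c1 s else run c2 s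
  | While _ _ => s
  end.

Section Semantics.
Variable R : realType.
Implicit Types (s : state R) (c : cmd).

Definition halts_within c s (T : nat) (post : state R -> Prop) : Prop :=
  exists t s', [/\ exec c s t s', (t <= T)%N & post s'].

Lemma halts_seq c1 c2 s T1 T2 (mid post : state R -> Prop) :
    halts_within c1 s T1 mid ->
    (forall s', mid s' -> halts_within c2 s' T2 post) ->
  halts_within (Seq c1 c2) s (T1 + T2) post.
Proof.
move=> [t1 [s1 [e1 le1 m1]]] /(_ s1 m1) [t2 [s2 [e2 le2 p2]]].
by exists (t1 + t2)%N, s2; split; [apply: ExecSeq e1 e2|apply: leq_add|].
Qed.

Lemma halts_weaken c s T T' (post post' : state R -> Prop) :
    (T <= T')%N -> (forall s', post s' -> post' s') ->
  halts_within c s T post -> halts_within c s T' post'.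
Proof.
move=> leT imp [t [s' [e le p]]]; exists t, s'.
by split; [|apply: leq_trans leT|apply: imp].
Qed.

Lemma halts_run c s (post : state R -> Prop) :
  loopfree c -> post (run c s) -> halts_within c s (cmd_size c) post.
Proof.
move=> lf p; suff [t e le] : exists2 t, exec c s t (run c s) & (t <= cmd_size c)%N.
  by exists t, (run c s).
elim: c s lf {p} => [i|c1 IH1 c2 IH2|b c1 IH1 c2 IH2|//] s /=.
- by exists 1%N => //; apply: ExecDo.
- move=> /andP[lf1 lf2]; have [t1 e1 le1] := IH1 s lf1.
  have [t2 e2 le2] := IH2 (run c1 s) lf2.
  by exists (t1 + t2)%N; [apply: ExecSeq e1 e2|apply: leq_add].
move=> /andP[lf1 lf2]; case: ifPn => bs.
  have [t e le] := IH1 s lf1; exists t.+1; first exact: ExecIfTrue.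
  by rewrite ltnS; apply: leq_trans le (leq_addr _ _).
have [t e le] := IH2 s lf2; exists t.+1; first exact: ExecIfFalse.
by rewrite ltnS; apply: leq_trans le (leq_addl _ _).
Qed.

(** Induction on the number of remaining iterations, which the test reveals
    through the invariant. Each iteration pays one extra step for its test, and
    so does the exit. *)
Lemma halts_while b c s n (inv : nat -> state R -> Prop) :
    loopfree c ->
    (forall m s', inv m s' -> eval_test b s' = (m < n)%N) ->
    (forall m s', (m < n)%N -> inv m s' -> inv m.+1 (run c s')) ->
    inv 0%N s ->
  halts_within (While b c) s ((cmd_size c).+1 * n.+1) (inv n).
Proof.
move=> lf testE step inv0.
suff loop k m s' : (m + k)%N = n -> inv m s' ->
    halts_within (While b c) s' ((cmd_size c).+1 * k).+1 (inv n).
  by apply: halts_weaken (loop n 0%N s _ _) => //; rewrite mulnS addSn ltnS leq_addl.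
elim: k m s' => [|k IH] m s' mk inv'.
  move: mk; rewrite addn0 => mn; rewrite mn in inv'.
  exists 1%N, s'; split=> //; apply: ExecWhileFalse.
  by rewrite (testE _ _ inv') ltnn.
have mn : (m < n)%N by rewrite -mk addnS ltnS leq_addr.
have [t1 [s1 [e1 le1 inv1]]] := halts_run lf (step _ _ mn inv').
have [||t2 [s2 [e2 le2 inv2]]] := IH m.+1 s1; rewrite ?addSnnS //.
exists (t1 + t2).+1, s2; split=> //.
  by apply: ExecWhileTrue e1 e2; rewrite (testE _ _ inv').
by rewrite ltnS mulnS addSn -addnS leq_add.
Qed.

End Semantics.

(** * The rounding program *)

Local Notation "c1 ;; c2" := (Seq c1 c2) (at level 60, right associativity).
Local Notation cell a := (a, Const 0).
Local Notation entry a v := (a, Var v).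

(* Work space starts at array 10, beyond the input, the output and the solution
   of the relaxation. The arrays of naturals come first; those of reals are
   numbered independently, from [prof] on. *)
Local Notation n_items := 0%N.
Local Notation out_x := 2%N.
Local Notation out_y := 3%N.
Local Notation item := 10%N.
Local Notation one_n := 11%N.
Local Notation cand_J := 12%N.
Local Notation cand_H := 13%N.
Local Notation cand_i := 14%N.
Local Notation n_frac := 15%N.
Local Notation frac1 := 16%N.
Local Notation frac2 := 17%N.
Local Notation flag := 18%N.
Local Notation scratch := 19%N.
Local Notation mode := 20%N.
Local Notation zero_n := 21%N.

Local Notation prof := 0%N.
Local Notation iwgt := 2%N.
Local Notation lp_x := 4%N.
Local Notation lp_xh := 5%N.
Local Notation zero_r := 10%N.
Local Notation one_r := 11%N.
Local Notation prof_J := 12%N.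
Local Notation prof_H := 13%N.
Local Notation prof_i := 14%N.
Local Notation best := 15%N.

Definition skip : cmd := Do (NSet (cell scratch) 0).

(** No cell outside the input and the solution of the relaxation has a known
    value here, so even the constants are written afresh. *)
Definition setup : cmd :=
  Do (NSet (cell zero_n) 0) ;; Do (NSet (cell one_n) 1) ;;
  Do (RCast (cell zero_r) (cell zero_n)) ;; Do (RCast (cell one_r) (cell one_n)) ;;
  Do (RCast (cell prof_J) (cell zero_n)) ;; Do (RCast (cell prof_H) (cell zero_n)) ;;
  Do (NSet (cell n_frac) 0) ;; Do (NSet (cell frac1) 0) ;; Do (NSet (cell frac2) 0) ;;
  Do (NSet (cell item) 0).

(** The machine has no test for equality, but the values of a feasible point of
    the relaxation lie in [0, 1], so one that is not below [1] equals [1]. *)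
Definition scan_original : cmd :=
  Do (NSet (cell flag) 0) ;; Do (NSet (entry cand_i item) 0) ;;
  Do (NSet (entry cand_J item) 0) ;;
  If (RLt (entry lp_x item) (cell one_r))
    (If (RLt (cell zero_r) (entry lp_x item)) (Do (NSet (cell flag) 1)) skip)
    (Do (NSet (entry cand_J item) 1) ;;
     Do (RAdd (cell prof_J) (cell prof_J) (entry prof item))).

Definition scan_improved : cmd :=
  Do (NSet (entry cand_H item) 0) ;;
  If (RLt (entry lp_xh item) (cell one_r))
    (If (RLt (cell zero_r) (entry lp_xh item)) (Do (NSet (cell flag) 1)) skip)
    (Do (NSet (entry cand_H item) 1) ;;
     Do (RAdd (cell prof_H) (cell prof_H) (entry prof item))).

(** There are at most two fractional items, so a queue of length two suffices. *)
Definition record_fractional : cmd :=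
  If (NLt (cell zero_n) (cell flag))
    (Do (NMove (cell frac2) (cell frac1)) ;; Do (NMove (cell frac1) (cell item)) ;;
     Do (NAdd (cell n_frac) (cell n_frac) (cell one_n)))
    skip ;;
  Do (NAdd (cell item) (cell item) (cell one_n)).

Definition scan_item : cmd :=
  scan_original ;; scan_improved ;; record_fractional.

Definition order_pair : cmd :=
  If (RLt (entry iwgt frac1) (entry iwgt frac2))
    (Do (NMove (cell scratch) (cell frac1)) ;;
     Do (NMove (cell frac1) (cell frac2)) ;;
     Do (NMove (cell frac2) (cell scratch)))
    skip.

Definition add_lighter : cmd :=
  Do (NSet (entry cand_H frac2) 1) ;;
  Do (RAdd (cell prof_H) (cell prof_H) (entry prof frac2)).

Definition set_single : cmd :=
  Do (NSet (entry cand_i frac1) 1) ;;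
  Do (RMove (cell prof_i) (entry prof frac1)).

(** If nothing is fractional there is no single-item candidate. Its profit is
    then set to that of the first candidate, which [select] never prefers, as it
    asks for a strict improvement. *)
Definition settle : cmd :=
  If (NLt (cell zero_n) (cell n_frac))
    (If (NLt (cell one_n) (cell n_frac)) (order_pair ;; add_lighter) skip ;;
     set_single)
    (Do (RMove (cell prof_i) (cell prof_J))).

(** The mode is the position of the winner: [0] for the integral original
    copies, [1] for the improved ones, [2] for the single fractional item. *)
Definition select : cmd :=
  Do (NSet (cell mode) 0) ;; Do (RMove (cell best) (cell prof_J)) ;;
  If (RLt (cell best) (cell prof_H))
    (Do (NSet (cell mode) 1) ;; Do (RMove (cell best) (cell prof_H))) skip ;;
  If (RLt (cell best) (cell prof_i)) (Do (NSet (cell mode) 2)) skip ;;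
  Do (NSet (cell item) 0).

Definition write_item : cmd :=
  If (NLt (cell mode) (cell one_n))
    (Do (NMove (entry out_x item) (entry cand_J item)) ;;
     Do (NSet (entry out_y item) 0))
    (If (NLt (cell one_n) (cell mode))
       (Do (NMove (entry out_x item) (entry cand_i item)) ;;
        Do (NMove (entry out_y item) (entry cand_i item)))
       (Do (NMove (entry out_x item) (entry cand_H item)) ;;
        Do (NMove (entry out_y item) (entry cand_H item)))) ;;
  Do (NAdd (cell item) (cell item) (cell one_n)).

Definition for_items (body : cmd) : cmd :=
  While (NLt (cell item) (cell n_items)) body.

Definition steps2to4 : cmd :=
  setup ;; for_items scan_item ;; settle ;; select ;; for_items write_item.

Lemma sum_below (V : nmodType) n (A : pred 'I_n) (F : 'I_n -> V) (o : 'I_n) :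
  \sum_(j | A j && (j < o.+1)%N) F j =
  \sum_(j | A j && (j < o)%N) F j + (if A o then F o else 0).
Proof.
have ltS (j : 'I_n) : (j < o.+1)%N = (j == o) || (j < o)%N by rewrite ltnS leq_eqVlt.
case: ifP => Ao; last first.
  rewrite addr0; apply: eq_bigl => j; rewrite ltS.
  by case: eqP => [->|//]; rewrite Ao.
rewrite (bigD1 o) /=; last by rewrite Ao ltS eqxx.
rewrite addrC; congr (_ + _); apply: eq_bigl => j; rewrite ltS.
by case: eqP => [->|_]; rewrite ?ltnn ?andbF ?andbT.
Qed.

Lemma run_seq (R : realType) c1 c2 (s : state R) :
  run (c1 ;; c2) s = run c2 (run c1 s).
Proof. by []. Qed.

Lemma run_if (R : realType) (b : test) c1 c2 (s : state R) (v : bool) :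
  eval_test b s = v -> run (If b c1 c2) s = run (if v then c1 else c2) s.
Proof. by move=> /= ->; case: v. Qed.

(** * Correctness of the rounding program *)

Section Correctness.
Variables (R : realType) (I : instance R).
Local Notation n := (nitems I).
Variables x xh : 'I_n -> R.
Implicit Types (s : state R) (S T U : {set 'I_n}).

Definition stores_set s (a m : nat) S : Prop :=
  forall j : 'I_n, (j < m)%N -> nats s a j = (j \in S).

Record constants s : Prop := Constants {
  zero_nE : nats s zero_n 0 = 0%N;
  one_nE : nats s one_n 0 = 1%N;
  zero_rE : reals s zero_r 0 = 0;
  one_rE : reals s one_r 0 = 1
}.

(** The loop invariant. The three progress counters [mJ], [mH] and [mF] exist
    because one iteration updates the parts of the invariant one after the
    other; between iterations they all equal [m]. The list [G] enumerates the
    fractional items found so far, latest first. *)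
Record scanned (m mJ mH mF : nat) s : Prop := Scanned {
  scanned_input : holds_input I s;
  scanned_x : forall j : 'I_n, reals s lp_x j = x j;
  scanned_xh : forall j : 'I_n, reals s lp_xh j = xh j;
  scanned_constants : constants s;
  scanned_index : nats s item 0 = m;
  scanned_J : stores_set s cand_J mJ (int_set x);
  scanned_H : stores_set s cand_H mH (int_set xh);
  scanned_i : stores_set s cand_i mJ set0;
  scanned_prof_J :
    reals s prof_J 0 = \sum_(j | (j \in int_set x) && (j < mJ)%N) profit I j;
  scanned_prof_H :
    reals s prof_H 0 = \sum_(j | (j \in int_set xh) && (j < mH)%N) profit I j;
  scanned_frac : exists G : seq 'I_n,
    [/\ uniq G, G =i [pred j | (j \in frac_set x xh) && (j < mF)%N],
        nats s n_frac 0 = size G,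
        nats s frac1 0 = nth 0%N (map val G) 0
      & nats s frac2 0 = nth 0%N (map val G) 1]
}.

Lemma run_setup s :
    holds_input I s -> (forall j : 'I_n, reals s lp_x j = x j) ->
    (forall j : 'I_n, reals s lp_xh j = xh j) ->
  scanned 0 0 0 0 (run setup s).
Proof.
move=> inp sx sxh; split=> //=.
- by rewrite big_pred0 // => j; rewrite andbF.
- by rewrite big_pred0 // => j; rewrite andbF.
by exists [::]; split=> // j; rewrite !inE andbF.
Qed.

Hypothesis feas : lp_feasible x xh.
Hypothesis basic : lp_basic x xh.

Let x01 j : 0 <= x j <= 1. Proof. by have [_ _ /(_ j)[]] := feas. Qed.
Let xh01 j : 0 <= xh j <= 1. Proof. by have [_ _ /(_ j)[]] := feas. Qed.

Lemma in_int_set (u : 'I_n -> R) j :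
  0 <= u j <= 1 -> (j \in int_set u) = ~~ (u j < 1).
Proof. by rewrite inE lt_neqAle negb_and negbK => /andP[_ ->]; rewrite orbF. Qed.

Lemma run_scan_original (o : 'I_n) s :
    scanned o o o o s ->
  scanned o o.+1 o o (run scan_original s) /\
  nats (run scan_original s) flag 0 = (0 < x o < 1).
Proof.
move=> [inp sx sxh [z1 z2 z3 z4] si sJ sH sU sA sB sG].
have [_ _ _ /(_ o) [po _ _]] := inp.
have oJ := in_int_set (x01 o).
have sumS := sum_below [in int_set x] (profit I) o.
rewrite /scan_original /= /eval_test /= /rval /= /upd /= si sx z4 z3.
case: (ltP (x o) 1) oJ => xo oJ; [case: (ltP 0 (x o)) => xo0|];
  (split; last by rewrite ?andbF); split=> //=; rewrite /stores_set /= /upd /= ?si.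
all: try by rewrite sumS oJ ?addr0 // sA po.
all: move=> j; rewrite ltnS leq_eqVlt.
all: case: (eqVneq (j : nat) o) => [/val_inj ->|_ /= jo].
all: by [rewrite ?oJ ?inE|exact: sJ|exact: sU].
Qed.

Lemma run_scan_improved (o : 'I_n) s :
    scanned o o.+1 o o s -> nats s flag 0 = (0 < x o < 1) ->
  scanned o o.+1 o.+1 o (run scan_improved s) /\
  nats (run scan_improved s) flag 0 = (o \in frac_set x xh).
Proof.
move=> [inp sx sxh [z1 z2 z3 z4] si sJ sH sU sA sB sG] sf.
have [_ _ _ /(_ o) [po _ _]] := inp.
have oH := in_int_set (xh01 o).
have sumS := sum_below [in int_set xh] (profit I) o.
have oF : (o \in frac_set x xh) = (0 < x o < 1) || (0 < xh o < 1) by rewrite inE.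
rewrite /scan_improved /= /eval_test /= /rval /= /upd /= si sxh z4 z3 oF.
case: (ltP (xh o) 1) oH {oF} => xo oH; [case: (ltP 0 (xh o)) => xo0|];
  (split; last by rewrite /= /upd /= ?sf ?andbF ?orbF ?orbT);
  split=> //=; rewrite /stores_set /= /upd /= ?si.
all: try by rewrite sumS oH ?addr0 // sB po.
all: move=> j; rewrite ltnS leq_eqVlt.
all: case: (eqVneq (j : nat) o) => [/val_inj ->|_ /= jo].
all: by [rewrite ?oH ?inE|exact: sH].
Qed.

Lemma run_record_fractional (o : 'I_n) s :
    scanned o o.+1 o.+1 o s -> nats s flag 0 = (o \in frac_set x xh) ->
  scanned o.+1 o.+1 o.+1 o.+1 (run record_fractional s).
Proof.
move=> [inp sx sxh [z1 z2 z3 z4] si sJ sH sU sA sB [G [uG GE cE g1 g2]]] sf.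
have ltS (j : 'I_n) : (j < o.+1)%N = (j == o) || (j < o)%N by rewrite ltnS leq_eqVlt.
rewrite /record_fractional /= /eval_test /= /nval /= z1 sf.
case: (boolP (o \in frac_set x xh)) => oF /=; split=> //=;
  rewrite /nval /= /upd /= ?si ?z2 ?addn1 //.
- exists (o :: G); split=> //=.
  + by rewrite uG GE !inE ltnn andbF.
  + move=> j; move: (frac_set x xh) GE oF => F GE oF.
    by rewrite in_cons GE !inE ltS; case: eqP => [->|//]; rewrite oF.
  + by rewrite cE.
exists G; split=> // j; move: (frac_set x xh) GE oF => F GE oF.
by rewrite GE !inE ltS; case: eqP => [->|//]; rewrite (negbTE oF).
Qed.

Lemma run_scan_item m s :
  (m < n)%N -> scanned m m m m s -> scanned m.+1 m.+1 m.+1 m.+1 (run scan_item s).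
Proof.
move=> mn; rewrite -[m]/(val (Ordinal mn)) => sc.
have [sc1 f1] := run_scan_original sc.
have [sc2 f2] := run_scan_improved sc1 f1.
exact: run_record_fractional.
Qed.

(** The alternatives distinguish whether there is a fractional item. The returned
    pair is described only through [rounding], so that the later phases need not
    look at the relaxation again. *)
Definition settled s : Prop :=
  [/\ nats s n_items 0 = n, constants s & exists S T U,
    [/\ [/\ stores_set s cand_J n S, stores_set s cand_H n T & stores_set s cand_i n U],
        reals s prof_J 0 = sol_profit (S, set0),
        reals s prof_H 0 = sol_profit (set0, T)
      & (reals s prof_i 0 = sol_profit (set0, U) /\
         forall c, best_of [:: (set0, U); (S, set0); (set0, T)] c -> rounding x xh c)
        \/
        (reals s prof_i 0 = sol_profit (S, set0) /\
         forall c, best_of [:: (S, set0); (set0, T)] c -> rounding x xh c)]].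

(** The labelling of the two fractional items is the only freedom of the last
    case; choosing it touches nothing but the two registers and a scratch cell. *)
Lemma run_order_pair (i j : 'I_n) s :
    holds_input I s -> i != j ->
    nats s frac1 0 = i -> nats s frac2 0 = j ->
  exists i' j' : 'I_n,
    [/\ i' != j', [set i'; j'] = [set i; j], iweight I j' <= iweight I i',
        nats (run order_pair s) frac1 0 = i' /\ nats (run order_pair s) frac2 0 = j'
      & reals (run order_pair s) = reals s /\
        forall a k, a \notin [:: frac1; frac2; scratch] ->
          nats (run order_pair s) a k = nats s a k].
Proof.
move=> [_ _ _ io] ij f1 f2.
have [_ _ wi] := io i; have [_ _ wj] := io j.
rewrite /order_pair /= /eval_test /= /rval /= f1 f2 wi wj.
case: ltP => wij.
  exists j, i; split=> //=; first by rewrite eq_sym.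
  - by rewrite setUC.
  - exact: ltW.
  - split=> // a k; rewrite !inE !negb_or => /and3P[/negbTE a1 /negbTE a2 /negbTE a3].
    by rewrite /upd a1 a2 a3.
exists i, j; split=> //; split=> // a k.
by rewrite !inE !negb_or => /and3P[_ _ /negbTE a3]; rewrite /= /upd a3.
Qed.

(** Adding the profit of the lighter item [j'] to that of the improved items is
    right only if [j'] is not among them, which holds because its improved copy
    is fractional. *)
Lemma run_settle s : scanned n n n n s -> settled (run settle s).
Proof.
move=> [inp sx sxh [z1 z2 z3 z4] si sJ sH sU sA sB [G [uG GE cE g1 g2]]].
have [ni _ _ io] := inp.
have FE : frac_set x xh = [set j in G].
  by apply/setP => j; rewrite [RHS]inE GE [RHS]inE ltn_ord andbT.
have szG : (size G <= 2)%N.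
  by rewrite -(card_uniqP uG) -cardsE -FE; apply: card_frac_set.
have pJ : reals s prof_J 0 = sol_profit (int_set x, set0).
  by rewrite sA sol_profitE setU0; apply: eq_bigl => j /=; rewrite ltn_ord andbT.
have pH : reals s prof_H 0 = sol_profit (set0, int_set xh).
  by rewrite sB sol_profitE set0U; apply: eq_bigl => j; rewrite ltn_ord andbT.
case: G uG FE szG cE g1 g2 {GE} => [|i [|j [|//]]] uG FE _ cE g1 g2.
- rewrite /settle (@run_if _ _ _ _ _ false); last by rewrite /= /nval /= z1 cE.
  split=> //; exists (int_set x), (int_set xh), set0; split=> //; right; split=> // c.
  by apply: Step2; rewrite FE; apply/setP => j; rewrite !inE.
- rewrite /settle (@run_if _ _ _ _ _ true); last by rewrite /= /nval /= z1 cE.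
  have [pi _ _] := io i.
  rewrite [run _ _]/= /eval_test /nval /= z2 cE /=.
  split=> //; exists (int_set x), (int_set xh), [set i]; split=> //.
    split=> // j _; rewrite /= /upd /= g1 /= !inE.
    case: eqVneq => [/val_inj ->|]; first by rewrite eqxx.
    by move=> ji; rewrite sU // inE; move: ji; rewrite -val_eqE /= => /negbTE ->.
  left; split=> [|c].
    by rewrite /= /rval /= /upd /= g1 pi sol_profitE set0U big_set1.
  by apply: Step3; rewrite FE; apply/setP => j; rewrite !inE.
have ij : i != j by move: uG; rewrite /= inE andbT.
have {}FE : frac_set x xh = [set i; j] by rewrite FE; apply/setP => l; rewrite !inE.
have [i' [j' [ij' FE' wij [f1 f2] [rs ns]]]] := run_order_pair inp ij g1 g2.
rewrite -{}FE' in FE.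
have Fi : i' \in frac_set x xh by rewrite FE !inE eqxx.
have Fj : j' \in frac_set x xh by rewrite FE !inE eqxx orbT.
have [_ fj _ _] := two_items_fractional feas basic ij' Fi Fj.
have jH := fractional_notin fj.
rewrite /settle (@run_if _ _ _ _ _ true); last by rewrite /= /nval /= z1 cE.
rewrite run_seq (@run_if _ _ _ _ _ true); last by rewrite /= /nval /= z2 cE.
rewrite run_seq; move: (run order_pair s) f1 f2 rs ns => s1 f1 f2 rs ns.
have [pi _ _] := io i'; have [pj _ _] := io j'.
split; rewrite /=; first by rewrite /upd /= ns.
  by split; rewrite /= /upd /= ?ns ?rs.
exists (int_set x), (j' |: int_set xh), [set i']; split.
- split=> l ln; rewrite /= /upd /= ?f1 ?f2 /=.
  + by rewrite ns // sJ.
  + rewrite in_setU1 -val_eqE /=; case: eqVneq => //= _.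
    by rewrite ns // sH.
  rewrite in_set1 -val_eqE /=; case: eqVneq => //= _.
  by rewrite ns // sU // inE.
- by rewrite /= /upd /= rs.
- rewrite /= /upd /= /rval /= /upd /= f2 rs pH pj !sol_profitE !set0U.
  by rewrite big_setU1 //= addrC.
left; split=> [|c]; last exact: Step4 FE wij.
by rewrite /= /rval /= /upd /= f1 rs pi sol_profitE set0U big_set1.
Qed.

(** The entries of the winning candidate, read off from the candidate arrays; the
    output arrays are still to be filled. *)
Definition pick_x s j : nat :=
  if (nats s mode 0 < 1)%N then nats s cand_J j
  else if (1 < nats s mode 0)%N then nats s cand_i j else nats s cand_H j.

Definition pick_y s j : nat :=
  if (nats s mode 0 < 1)%N then 0%N
  else if (1 < nats s mode 0)%N then nats s cand_i j else nats s cand_H j.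

Record written S T (m : nat) s : Prop := Written {
  written_n : nats s n_items 0 = n;
  written_one : nats s one_n 0 = 1%N;
  written_index : nats s item 0 = m;
  written_pick : forall j : 'I_n,
    pick_x s j = packed S T j /\ pick_y s j = improved S T j;
  written_out : forall j : 'I_n, (j < m)%N ->
    nats s out_x j = packed S T j /\ nats s out_y j = improved S T j
}.

Lemma run_select s :
  settled s -> exists S T, rounding x xh (S, T) /\ written S T 0 (run select s).
Proof.
move=> [ni [z1 z2 z3 z4] [S [T [U [[sS sT sU] pS pT choice]]]]].
rewrite /select /= /eval_test /= /rval /= /upd /=.
rewrite pS pT.
have pack0 V (j : 'I_n) : packed set0 V j = (j \in V) by rewrite /packed set0U.
case: (ltP (sol_profit (S, set0)) (sol_profit (set0, T))) => AB;
  rewrite /= /upd /= ?pS ?pT; case: ltP => Cbest.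
- exists set0, U; case: choice => [[pC rnd]|[pC _]]; last first.
    by exfalso; rewrite pC in Cbest; clear ni z1 z2; lra.
  split; last first.
    by split=> //= j; rewrite /pick_x /pick_y /= /upd /= pack0 /improved !sU.
  apply: rnd; rewrite pC in Cbest; split=> [|c]; rewrite !inE ?eqxx //.
  by case/or3P=> /eqP->; clear ni z1 z2; lra.
- exists set0, T; split; last first.
    by split=> //= j; rewrite /pick_x /pick_y /= /upd /= pack0 /improved !sT.
  by case: choice => [[pC rnd]|[pC rnd]]; apply: rnd; rewrite pC in Cbest;
    (split=> [|c]; rewrite !inE ?eqxx ?orbT //);
    [case/or3P|case/orP]=> /eqP->; clear ni z1 z2; lra.
- exists set0, U; case: choice => [[pC rnd]|[pC _]]; last first.
    by exfalso; rewrite pC in Cbest; clear ni z1 z2; lra.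
  split; last first.
    by split=> //= j; rewrite /pick_x /pick_y /= /upd /= pack0 /improved !sU.
  apply: rnd; rewrite pC in Cbest; split=> [|c]; rewrite !inE ?eqxx //.
  by case/or3P=> /eqP->; clear ni z1 z2; lra.
exists S, set0; split; last first.
  by split=> //= j; rewrite /pick_x /pick_y /= /upd /= /packed /improved setU0 inE !sS.
by case: choice => [[pC rnd]|[pC rnd]]; apply: rnd; rewrite pC in Cbest;
  (split=> [|c]; rewrite !inE ?eqxx ?orbT //);
    [case/or3P|case/orP]=> /eqP->; clear ni z1 z2; lra.
Qed.

Lemma run_write_item S T m s :
  (m < n)%N -> written S T m s -> written S T m.+1 (run write_item s).
Proof.
move=> mn; rewrite -[m]/(val (Ordinal mn)); move: (Ordinal mn) => o [ni o1 si pk out].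
have [px py] := pk o; move: px py pk; rewrite /pick_x /pick_y.
rewrite /write_item /= /eval_test /= /nval /= o1.
have out' (f g : nat -> nat) : f o = packed S T o -> g o = improved S T o ->
    forall j : 'I_n, (j < o.+1)%N ->
    (if j == \val o :> nat then f o else nats s out_x j) = packed S T j /\
    (if j == \val o :> nat then g o else nats s out_y j) = improved S T j.
  move=> fo go j; rewrite ltnS leq_eqVlt.
  by case: (eqVneq (j : nat) o) => [/val_inj ->|_ /= /out].
case: ifP => [lt|ge]; [|case: ifP => lt]; move=> px py pk; split=> //=;
  (try by rewrite /upd /= si o1 addn1) => j;
  rewrite /pick_x /pick_y /= /upd /= ?si ?o1 ?addn1 ?ge ?lt //;
  try (by have := pk j; rewrite ?ge ?lt).
- exact: (out' _ (fun=> 0%N)).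
- exact: out'.
- exact: out'.
Qed.

(** Each phase is loop-free or a loop over the items with a loop-free body, so the
    length of the program bounds the steps spent per item. *)
Lemma steps2to4_correct s :
    holds_input I s -> (forall j : 'I_n, reals s lp_x j = x j) ->
    (forall j : 'I_n, reals s lp_xh j = xh j) ->
  halts_within steps2to4 s (cmd_size steps2to4 * n.+1) (fun s' =>
    exists S T, rounding x xh (S, T) /\
      forall j : 'I_n,
        nats s' out_x j = packed S T j /\ nats s' out_y j = improved S T j).
Proof.
move=> inp sx sxh.
have scan s1 : scanned 0 0 0 0 s1 ->
    halts_within (for_items scan_item) s1 ((cmd_size scan_item).+1 * n.+1)
      (scanned n n n n).
  move=> sc; apply: (halts_while (inv := fun m => scanned m m m m)) => // m s2.
    by move=> [[ni _ _ _] _ _ _ si _ _ _ _ _ _]; rewrite /= /nval /= ni si.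
  exact: run_scan_item.
have write S T s1 : written S T 0 s1 ->
    halts_within (for_items write_item) s1 ((cmd_size write_item).+1 * n.+1)
      (written S T n).
  move=> wr; apply: (halts_while (inv := written S T)) => // m s2.
    by move=> [ni _ si _ _]; rewrite /= /nval /= ni si.
  exact: run_write_item.
apply: (halts_weaken (post := fun s' =>
    exists S T, rounding x xh (S, T) /\ written S T n s'));
  last first.
- apply: halts_seq (halts_run (post := scanned 0 0 0 0) _ _) _ => //.
    exact: run_setup.
  move=> s1 /scan h1; apply: halts_seq h1 _ => s2 sc.
  apply: halts_seq (halts_run (post := settled) _ _) _ => //; first exact: run_settle.
  move=> s3 st; apply: halts_seq (halts_run (post := fun s' =>
    exists S T, rounding x xh (S, T) /\ written S T 0 s') _ _) _ => //.
    exact: run_select.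
  move=> s4 [S [T [rnd wr]]].
  apply: halts_weaken (leqnn _) _ (write S T _ wr) => s5 wr5.
  by exists S, T.
- move=> s' [S [T [rnd [_ _ _ _ out]]]]; exists S, T; split=> // j.
  exact: out.
by rewrite /=; lia.
Qed.

End Correctness.

Lemma linear_time_steps2to4 (R : realType) (lp : cmd) :
  linear_time_lp_solver R lp -> linear_time_algorithmA R (Seq lp steps2to4).
Proof.
move=> [C lpC]; exists (C + cmd_size steps2to4)%N => I vI.
have [t1 [s1 [e1 le1 [inp opt]]]] := lpC I vI.
have [[feas _] basic] := opt.
have [t2 [s2 [e2 le2 [S [T [rnd out]]]]]] :=
  steps2to4_correct feas basic inp (fun=> erefl) (fun=> erefl).
exists (t1 + t2)%N, s2; split; first exact: ExecSeq e1 e2.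
  by rewrite mulnDl leq_add.
by exists S, T; split=> //; eexists _, _; split; [exact: opt|].
Qed.

Theorem theorem5p2 (R : realType) :
  (forall (I : instance R), valid I ->
     (forall x xh : 'I_(nitems I) -> R, lp_optimal_basic x xh ->
        exists S T : {set 'I_(nitems I)}, rounding x xh (S, T)) /\
     (forall S T : {set 'I_(nitems I)},
        algorithmA S T -> approximates 3 S T)) /\
  (exists steps2to4 : cmd, forall lp : cmd,
     linear_time_lp_solver R lp ->
     linear_time_algorithmA R (Seq lp steps2to4)).
Proof.
split=> [I vI|]; last by exists steps2to4; exact: linear_time_steps2to4.
split=> [x xh [_ basic]|S T [x [xh [opt rnd]]]]; first exact: rounding_exists.
exact: rounding_approximates opt rnd.
Qed.
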